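(* For all integers $n,m\ge0$ and every $x$, \[ \sum_{i=0}^{n}q^{n-i}\mathcal{S}_n^i\!\Big(\frac{x}{q}\Big)\mathcal{C}_{i,m}^{(k)}(a,q,L;x)=\frac{(a+m)^k\,l^{n+a}}{a^k(a+n+m)^k}. \]
   Context: Let $k\ge1$ be an integer, $a,q,l_1,\dots,l_k$ nonzero reals, $l=\prod l_i$, $L=(l_1,\dots,l_k)$; denominators $a+j$ ($j\ge0$ integer) assumed nonzero and $l^{a+i}$ means $l^al^i$. Let $\operatorname{Lif}_k(w;b)=\sum_{n\ge0}\frac{1}{(n+b)^k}\frac{w^n}{n!}$. The generalized $m$-poly-Cauchy polynomials of the first kind are defined by \[ \frac{l^a(a+m)^k}{a^k(1+qz)^{x/q}}\operatorname{Lif}_k\!\Big(\frac{l\ln(1+qz)}{q};a+m\Big)=\sum_{n\ge0}\mathcal{C}_{n,m}^{(k)}(a,q,L;x)\frac{z^n}{n!}. \] The weighted Stirling numbers of the second kind are defined by $\sum_{n\ge i}\mathcal{S}_n^i(x)\frac{z^n}{n!}=\frac{1}{i!}e^{xz}(e^z-1)^i$, equivalently $\mathcal{S}_n^i(x)=\frac{1}{i!}\sum_{j=0}^i\binom{i}{j}(-1)^{i-j}(x+j)^n$. *)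

(* Defs.v *)
From Stdlib Require Import Reals Lra Lia List ZArith.
From Coquelicot Require Import Coquelicot.
Open Scope R_scope.

Definition prod_list (L : list R) : R := fold_right Rmult 1 L.

Definition Lif (k : nat) (w b : R) : R :=
  Series (fun n => / (INR n + b) ^ k * (w ^ n / INR (fact n))).

(* [p] is a value of l^a: the positive real power when l > 0; when l < 0, any
   determination exp (a (ln |l| + (2j+1) i pi)). *)
Definition is_power (l a : R) (p : C) : Prop :=
  (0 < l /\ p = RtoC (Rpower l a)) \/
  (l < 0 /\ exists j : Z,
     let t := a * ((2 * IZR j + 1) * PI) in
     p = (RtoC (Rpower (- l) a) * (cos t, sin t))%C).

(* [la] stands for l^a, where l is the product of [L]. *)
Definition poly_cauchy_gf (k : nat) (a q : R) (L : list R) (la : C)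
    (m : nat) (x z : R) : C :=
  (la * RtoC ((a + INR m) ^ k / (a ^ k * Rpower (1 + q * z) (x / q)) *
              Lif k (prod_list L * ln (1 + q * z) / q) (a + INR m)))%C.

Definition is_egf (c : nat -> C) (G : R -> C) : Prop :=
  locally 0 (fun z : R =>
    is_series (V := C_R_NormedModule)
      (fun n => (c n * RtoC (z ^ n / INR (fact n)))%C) (G z)).

Definition is_poly_cauchy (k : nat) (a q : R) (L : list R) (la : C)
    (m : nat) (x : R) (c : nat -> C) : Prop :=
  is_egf c (poly_cauchy_gf k a q L la m x).

Definition wstirling2 (n i : nat) (x : R) : R :=
  / INR (fact i) *
  sum_n (fun j => Binomial.C i j * (-1) ^ (i - j) * (x + INR j) ^ n) i.

(* The generating function of the weighted Stirling numbers. *)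
Lemma wstirling2_egf (i : nat) (x z : R) :
  is_series (fun n => wstirling2 n i x * (z ^ n / INR (fact n)))
    (/ INR (fact i) * (exp (x * z) * (exp z - 1) ^ i)).
Proof.
  assert (Hs : forall (u : nat -> nat -> R) (v : nat -> R) N,
    (forall j, is_series (fun n => u n j) (v j)) ->
    is_series (fun n => sum_n (u n) N) (sum_n v N)).
  { intros u v N Huv. induction N as [|N IH].
    - rewrite sum_O. apply is_series_ext with (fun n => u n O); auto.
      intros n; rewrite sum_O; reflexivity.
    - rewrite sum_Sn.
      apply is_series_ext with (fun n => plus (sum_n (u n) N) (u n (S N))).
      { intros n; rewrite sum_Sn; reflexivity. }
      apply (is_series_plus (V := R_NormedModule)); auto. }
  replace (exp (x * z) * (exp z - 1) ^ i) with
    (sum_n (fun j => Binomial.C i j * (-1) ^ (i - j) * exp ((x + INR j) * z)) i).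
  2:{ unfold Rminus. rewrite binomial, sum_n_Reals, scal_sum.
      apply sum_eq; intros j _.
      rewrite Rmult_plus_distr_r, exp_plus.
      replace (exp (INR j * z)) with (exp z ^ j).
      2:{ induction j; [simpl; rewrite Rmult_0_l, exp_0; reflexivity|].
          rewrite S_INR, Rmult_plus_distr_r, exp_plus, Rmult_1_l, <- IHj; simpl; ring. }
      replace (Ropp 1) with (-1) by lra. ring. }
  apply is_series_ext with (fun n => scal (/ INR (fact i))
    (sum_n (fun j => Binomial.C i j * (-1) ^ (i - j) * (((x + INR j) * z) ^ n / INR (fact n))) i)).
  { intros n. unfold wstirling2, scal; simpl; unfold mult; simpl.
    rewrite Rmult_assoc. f_equal.
    rewrite !sum_n_Reals, (Rmult_comm (sum_f_R0 _ _)), scal_sum.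
    apply sum_eq; intros j _. rewrite Rpow_mult_distr. unfold Rdiv; ring. }
  apply (is_series_scal (V := R_NormedModule)).
  apply (Hs (fun n j => Binomial.C i j * (-1) ^ (i - j) * (((x + INR j) * z) ^ n / INR (fact n)))).
  intros j. apply (is_series_scal (V := R_NormedModule)
    (Binomial.C i j * (-1) ^ (i - j)) (fun n => ((x + INR j) * z) ^ n / INR (fact n))).
  generalize (proj1 (is_pseries_R _ _ _) (is_exp_Reals ((x + INR j) * z))).
  apply is_series_ext; intros n. apply Rmult_comm.
Qed.

(* The remaining facts show that [is_poly_cauchy] is satisfiable
   ([poly_cauchy_exists]): the generating function is analytic at 0, by Taylor
   expansion with explicit bounds on its derivatives [TD]. *)
Section Taylor.
Variables (r M K : R).
Hypothesis (hr : 0 < r) (hK : 0 <= K).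

Let smooth (D : nat -> R -> R) :=
  (forall n z, Rabs z < r -> is_derive (D n) z (D (S n) z)) /\
  (forall n z, Rabs z < r -> Rabs (D n z) <= M * K ^ n * INR (fact n)).

Lemma Derive_n_family (D : nat -> R -> R) : smooth D ->
  forall n z, Rabs z < r -> ex_derive_n (D 0%nat) n z /\ Derive_n (D 0%nat) n z = D n z.
Proof.
  intros [HD _].
  assert (HDn : forall n z, Rabs z < r -> Derive_n (D 0%nat) n z = D n z).
  { induction n as [|n IH]; intros z Hz; [reflexivity|]. simpl.
    rewrite (Derive_ext_loc _ (D n)).
    - apply is_derive_unique, HD, Hz.
    - assert (He : 0 < r - Rabs z) by lra.
      exists (mkposreal _ He); intros y Hy; apply IH.
      unfold ball in Hy; simpl in Hy; unfold AbsRing_ball, abs, minus, plus, opp in Hy; simpl in Hy.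
      replace y with (z + (y + - z)) by ring.
      eapply Rle_lt_trans; [apply Rabs_triang|]; lra. }
  intros n z Hz; split; [|auto].
  destruct n as [|n]; [exact I|]. simpl.
  apply ex_derive_ext_loc with (D n).
  - assert (He : 0 < r - Rabs z) by lra.
    exists (mkposreal _ He); intros y Hy; symmetry; apply HDn.
    unfold ball in Hy; simpl in Hy; unfold AbsRing_ball, abs, minus, plus, opp in Hy; simpl in Hy.
    replace y with (z + (y + - z)) by ring.
    eapply Rle_lt_trans; [apply Rabs_triang|]; lra.
  - eexists; apply HD, Hz.
Qed.

Lemma taylor_pos (D : nat -> R -> R) (z : R) : smooth D -> 0 < z < r -> K * z < 1 ->
  is_series (fun n => D n 0 * (z ^ n / INR (fact n))) (D 0%nat z).
Proof.
  intros HD Hz HKz.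
  pose proof (Derive_n_family D HD) as HDn.
  assert (Hlim : is_lim_seq (fun n => M * (K * z) ^ S n) 0).
  { replace (Finite 0) with (Rbar_mult M 0) by (simpl; f_equal; ring).
    apply (is_lim_seq_scal_l (fun n => (K * z) ^ S n) M 0).
    apply (is_lim_seq_incr_1 (fun n => (K * z) ^ n)), is_lim_seq_geom.
    rewrite Rabs_pos_eq; [lra|]. apply Rmult_le_pos; lra. }
  change (is_lim_seq (sum_n (fun n => D n 0 * (z ^ n / INR (fact n)))) (D 0%nat z)).
  assert (Hb : forall n, Rabs (sum_n (fun n => D n 0 * (z ^ n / INR (fact n))) n - D 0%nat z)
     <= M * (K * z) ^ S n).
  { intros n. destruct (Taylor_Lagrange (D 0%nat) n 0 z) as (t & Ht & ->); [lra| |].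
    - intros t Ht j _. apply HDn. rewrite Rabs_pos_eq; lra.
    - assert (Hta : Rabs t < r) by (rewrite Rabs_pos_eq; lra).
      assert (H0 : Rabs 0 < r) by (rewrite Rabs_R0; lra).
      rewrite Rminus_0_r, sum_n_Reals.
      rewrite (sum_eq _ (fun m => z ^ m / INR (fact m) * Derive_n (D 0%nat) m 0) n).
      2:{ intros j _. rewrite (proj2 (HDn j 0 H0)); ring. }
      rewrite (proj2 (HDn (S n) t Hta)).
      match goal with |- Rabs (?A - (?A + ?B)) <= _ => replace (A - (A + B)) with (- B) by ring end.
      rewrite Rabs_Ropp, Rabs_mult, Rabs_pos_eq.
      2:{ apply Rmult_le_pos; [apply pow_le; lra|].
          left; apply Rinv_0_lt_compat, INR_fact_lt_0. }
      eapply Rle_trans.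
      { apply Rmult_le_compat_l, (proj2 HD (S n) t Hta).
        apply Rmult_le_pos; [apply pow_le; lra|].
        left; apply Rinv_0_lt_compat, INR_fact_lt_0. }
      rewrite Rpow_mult_distr. right. field. apply INR_fact_neq_0. }
  apply is_lim_seq_ext with
    (fun n => D 0%nat z + (sum_n (fun n => D n 0 * (z ^ n / INR (fact n))) n - D 0%nat z)).
  { intros n; ring. }
  replace (Finite (D 0%nat z)) with (Finite (D 0%nat z + 0)) by (f_equal; ring).
  apply is_lim_seq_plus'; [apply is_lim_seq_const|].
  apply is_lim_seq_abs_0.
  apply is_lim_seq_le_le with (fun _ => 0) (fun n => M * (K * z) ^ S n); auto.
  - intros n; split; [apply Rabs_pos | apply Hb].
  - apply is_lim_seq_const.
Qed.

Lemma taylor_series (D : nat -> R -> R) : smooth D ->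
  locally 0 (fun z => is_series (fun n => D n 0 * (z ^ n / INR (fact n))) (D 0%nat z)).
Proof.
  intros HD.
  assert (He : 0 < Rmin r (/ (K + 1))).
  { apply Rmin_pos; auto. apply Rinv_0_lt_compat; lra. }
  exists (mkposreal _ He); intros z Hz.
  unfold ball in Hz; simpl in Hz; unfold AbsRing_ball, abs, minus, plus, opp in Hz; simpl in Hz.
  rewrite Ropp_0, Rplus_0_r in Hz.
  pose proof (Rmin_l r (/ (K + 1))). pose proof (Rmin_r r (/ (K + 1))).
  assert (HK1 : K * Rabs z < 1).
  { apply Rle_lt_trans with ((K + 1) * Rabs z).
    - apply Rmult_le_compat_r; [apply Rabs_pos|lra].
    - apply Rmult_lt_reg_l with (/ (K + 1)); [apply Rinv_0_lt_compat; lra|].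
      rewrite <- Rmult_assoc, Rinv_l by lra. lra. }
  destruct (Rtotal_order z 0) as [Hn|[->|Hp]].
  - rewrite Rabs_left in * by lra.
    set (D' := fun n y => (-1) ^ n * D n (- y)).
    assert (HD' : smooth D').
    { split; intros n y Hy; unfold D'.
      - evar_last.
        + apply (is_derive_scal (fun y => D n (- y)) y ((-1) ^ n)).
          apply (is_derive_comp (D n) Ropp y).
          * apply HD. rewrite Rabs_Ropp; exact Hy.
          * apply (is_derive_opp (K := R_AbsRing) (V := R_NormedModule) (fun y => y) y 1).
            apply (is_derive_id (K := R_AbsRing)).
        + unfold scal, opp; simpl; unfold mult; simpl. ring.
      - rewrite Rabs_mult, <- RPow_abs, (Rabs_left (-1)) by lra; replace (- -1) with 1 by ring; rewrite pow1, Rmult_1_l.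
        apply HD. rewrite Rabs_Ropp; exact Hy. }
    generalize (taylor_pos D' (- z) HD').
    unfold D' at 2; simpl. rewrite Ropp_involutive, Rmult_1_l. intros Ht.
    eapply is_series_ext; [|apply Ht; lra].
    intros n; unfold D'; simpl. rewrite Ropp_0.
    replace (- z) with ((-1) * z) by ring. rewrite Rpow_mult_distr.
    replace ((-1) ^ n * D n 0 * ((-1) ^ n * z ^ n / INR (fact n))) with
      (((-1) ^ n * (-1) ^ n) * (D n 0 * (z ^ n / INR (fact n)))) by (unfold Rdiv; ring).
    rewrite <- Rpow_mult_distr. replace (-1 * -1) with 1 by ring. rewrite pow1; ring.
  - apply (filterlim_ext (fun _ => D 0%nat 0)); [|apply filterlim_const].
    intros n. rewrite sum_n_Reals. induction n as [|n IH]; simpl; [field|].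
    simpl in IH. rewrite <- IH. unfold Rdiv; ring.
  - rewrite Rabs_pos_eq in * by lra. apply taylor_pos; auto; lra.
Qed.
End Taylor.

Lemma INR_dist_bound (a : R) : (forall j : nat, a + INR j <> 0) ->
  exists d, 0 < d /\ forall j : nat, d <= Rabs (a + INR j).
Proof.
  intros Ha.
  assert (Hfin : forall N, exists d, 0 < d <= 1 /\ forall j, (j < N)%nat -> d <= Rabs (a + INR j)).
  { induction N as [|N [d [Hd IH]]].
    - exists 1; split; [lra|]; intros; lia.
    - exists (Rmin d (Rabs (a + INR N))). split.
      + split; [apply Rmin_pos; [lra|apply Rabs_pos_lt, Ha]|].
        eapply Rle_trans; [apply Rmin_l|lra].
      + intros j Hj. destruct (Nat.eq_dec j N) as [->|]; [apply Rmin_r|].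
        eapply Rle_trans; [apply Rmin_l|apply IH; lia]. }
  destruct (INR_unbounded (1 - a)) as [N HN].
  destruct (Hfin N) as [d [Hd Hj]]. exists d; split; [lra|].
  intros j. destruct (Nat.lt_ge_cases j N) as [|Hge]; [auto|].
  apply le_INR in Hge. rewrite Rabs_pos_eq; lra.
Qed.

Section Existence.
Variables (k : nat) (b d : R).
Hypothesis (hd : 0 < d) (hbd : forall j : nat, d <= Rabs (b + INR j)).

Let cf (i n : nat) := / (INR n + (b + INR i)) ^ k / INR (fact n).

Lemma cf_bound i n : Rabs (cf i n) <= (/ d) ^ k * / INR (fact n).
Proof.
  assert (Hne : INR n + (b + INR i) <> 0).
  { generalize (hbd (n + i)). rewrite plus_INR. intros H E.
    replace (b + (INR n + INR i)) with (INR n + (b + INR i)) in H by ring.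
    rewrite E, Rabs_R0 in H; lra. }
  unfold cf, Rdiv. rewrite Rabs_mult, (Rabs_pos_eq (/ INR (fact n))).
  2:{ left; apply Rinv_0_lt_compat, INR_fact_lt_0. }
  apply Rmult_le_compat_r; [left; apply Rinv_0_lt_compat, INR_fact_lt_0|].
  rewrite <- pow_inv, <- RPow_abs. apply pow_incr; split; [apply Rabs_pos|].
  rewrite Rabs_inv. apply Rinv_le_contravar; auto.
  replace (INR n + (b + INR i)) with (b + INR (n + i)) by (rewrite plus_INR; ring). apply hbd.
Qed.

Lemma exp_abs_series w : is_series (fun n => (/ d) ^ k * / INR (fact n) * Rabs w ^ n) ((/ d) ^ k * exp (Rabs w)).
Proof.
  generalize (proj1 (is_pseries_R _ _ _) (is_exp_Reals (Rabs w))). intros H.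
  apply (is_series_scal (V := R_NormedModule) ((/ d) ^ k)) in H.
  revert H. apply is_series_ext; intros n. unfold scal; simpl; unfold mult; simpl. ring.
Qed.

Lemma cf_abs i w n : Rabs (cf i n * w ^ n) <= (/ d) ^ k * / INR (fact n) * Rabs w ^ n.
Proof.
  rewrite Rabs_mult, <- RPow_abs. apply Rmult_le_compat_r; [apply pow_le, Rabs_pos|apply cf_bound].
Qed.

Lemma cf_summable i w : ex_series (fun n => Rabs (cf i n * w ^ n)).
Proof.
  apply (ex_series_le (K := R_AbsRing) (V := R_CompleteNormedModule)) with (fun n => (/ d) ^ k * / INR (fact n) * Rabs w ^ n).
  - intros n. unfold norm; simpl; unfold abs; simpl. rewrite Rabs_Rabsolu. apply cf_abs.
  - eexists; apply exp_abs_series.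
Qed.

Lemma Lif_PSeries i w : Lif k w (b + INR i) = PSeries (cf i) w.
Proof. apply Series_ext; intros n; unfold cf, Rdiv; ring. Qed.

Lemma Lif_bound i w : Rabs (Lif k w (b + INR i)) <= (/ d) ^ k * exp (Rabs w).
Proof.
  rewrite Lif_PSeries. eapply Rle_trans; [apply Series_Rabs, cf_summable|].
  rewrite <- (is_series_unique _ _ (exp_abs_series w)).
  apply Series_le; [|eexists; apply exp_abs_series].
  intros n; split; [apply Rabs_pos|apply cf_abs].
Qed.

Lemma cf_radius i w : Rbar_lt (Rabs w) (CV_radius (cf i)).
Proof.
  apply Rbar_lt_le_trans with (Rabs w + 1); [simpl; lra|].
  apply (proj1 (CV_radius_bounded (cf i))).
  destruct (cf_summable i (Rabs w + 1)) as [s Hs].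
  exists ((/ d) ^ k * exp (Rabs (Rabs w + 1))). intros n.
  eapply Rle_trans; [apply cf_abs|].
  set (u := fun n => (/ d) ^ k * / INR (fact n) * Rabs (Rabs w + 1) ^ n).
  assert (Hu : forall j, 0 <= u j).
  { intros j; unfold u. repeat apply Rmult_le_pos.
    - apply pow_le; left; apply Rinv_0_lt_compat, hd.
    - left; apply Rinv_0_lt_compat, INR_fact_lt_0.
    - apply pow_le, Rabs_pos. }
  change (u n <= (/ d) ^ k * exp (Rabs (Rabs w + 1))).
  apply Rle_trans with (sum_n u n).
  - rewrite sum_n_Reals. destruct n as [|n]; simpl; [lra|].
    assert (0 <= sum_f_R0 u n) by (apply cond_pos_sum; auto). lra.
  - rewrite sum_n_Reals.
    apply sum_incr; auto.
    apply is_lim_seq_Reals. apply is_lim_seq_ext with (sum_n u).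
    + intros j; apply sum_n_Reals.
    + apply exp_abs_series.
Qed.

Lemma Lif_derive i w : is_derive (fun w => Lif k w (b + INR i)) w (Lif k w (b + INR (S i))).
Proof.
  apply is_derive_ext with (PSeries (cf i)); [intros; symmetry; apply Lif_PSeries|].
  rewrite Lif_PSeries, (PSeries_ext _ (PS_derive (cf i))).
  - apply is_derive_PSeries, cf_radius.
  - intros n. unfold PS_derive, cf.
    replace (INR n + (b + INR (S i))) with (INR (S n) + (b + INR i)) by (rewrite !S_INR; ring).
    change (fact (S n)) with (S n * fact n)%nat. rewrite mult_INR.
    assert (INR (S n) <> 0) by (apply not_0_INR; lia).
    set (X := / (INR (S n) + (b + INR i)) ^ k). field. split; auto. apply INR_fact_neq_0.
Qed.

Variables (q x l : R).
Hypothesis (hq : q <> 0).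

Let E (N i : nat) (z : R) :=
  exp (- (x / q + INR N) * ln (1 + q * z)) * Lif k (l * ln (1 + q * z) / q) (b + INR i).

Fixpoint TD (n N i : nat) (z : R) : R :=
  match n with
  | O => E N i z
  | S n => - (x + q * INR N) * TD n (S N) i z + l * TD n (S N) (S i) z
  end.

Let r := / (2 * Rabs q).

Lemma r_pos : 0 < r.
Proof. apply Rinv_0_lt_compat. generalize (Rabs_pos_lt q hq); lra. Qed.

Lemma base_bounds z : Rabs z < r -> / 2 <= 1 + q * z <= 2.
Proof.
  intros Hz. assert (H : Rabs (q * z) <= / 2).
  { rewrite Rabs_mult. apply Rle_trans with (Rabs q * r).
    - apply Rmult_le_compat_l; [apply Rabs_pos|lra].
    - unfold r. right; field. apply Rabs_no_R0, hq. }
  apply Rabs_le_between in H. lra.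
Qed.

Lemma TD_derive n : forall N i z, Rabs z < r -> is_derive (TD n N i) z (TD (S n) N i z).
Proof.
  induction n as [|n IH]; intros N i z Hz.
  - pose proof (base_bounds z Hz) as Hb.
    evar_last.
    + apply (is_derive_mult (K := R_AbsRing)
        (fun z => exp (- (x / q + INR N) * ln (1 + q * z)))
        (fun z => Lif k (l * ln (1 + q * z) / q) (b + INR i)) z
        (- (x / q + INR N) * (q / (1 + q * z)) * exp (- (x / q + INR N) * ln (1 + q * z)))
        (scal (l / (1 + q * z)) (Lif k (l * ln (1 + q * z) / q) (b + INR (S i))))).
      * auto_derive; [lra|]. field. split; lra.
      * apply (is_derive_comp (fun w => Lif k w (b + INR i))); [apply Lif_derive|].
        auto_derive; [lra|]. field. split; lra.
      * intros u v; apply Rmult_comm.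
    + unfold TD, E, plus, mult, scal; simpl. unfold mult; simpl.
      assert (HE : exp (- (x / q + INR (S N)) * ln (1 + q * z)) =
        exp (- (x / q + INR N) * ln (1 + q * z)) * / (1 + q * z)).
      { rewrite S_INR.
        replace (- (x / q + (INR N + 1)) * ln (1 + q * z)) with
          (- (x / q + INR N) * ln (1 + q * z) + - ln (1 + q * z)) by ring.
        rewrite exp_plus, exp_Ropp, exp_ln by lra. reflexivity. }
      change (match N with O => 1 | S _ => INR N + 1 end) with (INR (S N)).
      rewrite HE. field. split; lra.
  - change (is_derive (fun z => - (x + q * INR N) * TD n (S N) i z + l * TD n (S N) (S i) z) z
      (- (x + q * INR N) * TD (S n) (S N) i z + l * TD (S n) (S N) (S i) z)).
    apply (is_derive_plus (V := R_NormedModule)); apply is_derive_scal; auto.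
Qed.

Let M0 := exp (Rabs (x / q) * 1) * ((/ d) ^ k * exp (Rabs (l / q))).
Let K0 := Rabs x + Rabs q + Rabs l.

Lemma ln_bound z : Rabs z < r -> Rabs (ln (1 + q * z)) <= 1 /\ / (1 + q * z) <= 2.
Proof.
  intros Hz. pose proof (base_bounds z Hz). split.
  - assert (H2 : ln 2 <= 1).
    { rewrite <- (ln_exp 1). apply ln_le; [lra|]. generalize (exp_ineq1_le 1); lra. }
    assert (ln (1 + q * z) <= ln 2) by (apply ln_le; lra).
    assert (ln (/ 2) <= ln (1 + q * z)) by (apply ln_le; lra).
    rewrite ln_Rinv in * by lra. apply Rabs_le; lra.
  - rewrite <- (Rinv_inv 2). apply Rinv_le_contravar; lra.
Qed.

Lemma exp_le_mono u v : u <= v -> exp u <= exp v.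
Proof. intros [H| ->]; [left; apply exp_increasing, H|right; reflexivity]. Qed.

Lemma E_bound N i z : Rabs z < r -> Rabs (E N i z) <= M0 * 2 ^ N.
Proof.
  intros Hz. pose proof (base_bounds z Hz) as Hb. destruct (ln_bound z Hz) as [Hl Hi].
  unfold E, M0. rewrite Rabs_mult, (Rabs_pos_eq (exp _)) by (left; apply exp_pos).
  replace (exp (Rabs (x / q) * 1) * ((/ d) ^ k * exp (Rabs (l / q))) * 2 ^ N) with
    ((exp (Rabs (x / q) * 1) * 2 ^ N) * ((/ d) ^ k * exp (Rabs (l / q)))) by ring.
  apply Rmult_le_compat; [left; apply exp_pos|apply Rabs_pos| |].
  - replace (- (x / q + INR N) * ln (1 + q * z)) with
      (- (x / q) * ln (1 + q * z) + INR N * - ln (1 + q * z)) by ring.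
    rewrite exp_plus. apply Rmult_le_compat; try (left; apply exp_pos).
    + apply exp_le_mono. eapply Rle_trans; [apply Rle_abs|]. rewrite Rabs_mult, Rabs_Ropp.
      apply Rmult_le_compat_l; [apply Rabs_pos|exact Hl].
    + replace (exp (INR N * - ln (1 + q * z))) with ((/ (1 + q * z)) ^ N).
      * apply pow_incr; split; [left; apply Rinv_0_lt_compat; lra|exact Hi].
      * clear -Hb. induction N as [|N IH]; [simpl; rewrite Rmult_0_l, exp_0; reflexivity|].
        rewrite S_INR, Rmult_plus_distr_r, Rmult_1_l, exp_plus, <- IH, exp_Ropp, exp_ln by lra.
        simpl; ring.
  - eapply Rle_trans; [apply Lif_bound|].
    apply Rmult_le_compat_l; [apply pow_le; left; apply Rinv_0_lt_compat, hd|].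
    apply exp_le_mono. replace (l * ln (1 + q * z) / q) with (l / q * ln (1 + q * z)) by (field; auto).
    rewrite Rabs_mult. rewrite <- (Rmult_1_r (Rabs (l / q))) at 2.
    apply Rmult_le_compat_l; [apply Rabs_pos|exact Hl].
Qed.

Lemma TD_bound n : forall N i z, Rabs z < r ->
  Rabs (TD n N i z) * INR (fact N) <= M0 * 2 ^ (N + n) * K0 ^ n * INR (fact (N + n)).
Proof.
  assert (HK : 0 <= K0).
  { unfold K0. generalize (Rabs_pos x) (Rabs_pos q) (Rabs_pos l); lra. }
  induction n as [|n IH]; intros N i z Hz.
  - rewrite Nat.add_0_r. simpl. rewrite Rmult_1_r.
    apply Rmult_le_compat_r; [apply pos_INR|apply E_bound, Hz].
  - pose proof (IH (S N) i z Hz) as H1. pose proof (IH (S N) (S i) z Hz) as H2.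
    replace (N + S n)%nat with (S N + n)%nat by lia.
    set (B := M0 * 2 ^ (S N + n) * K0 ^ n * INR (fact (S N + n))) in *.
    replace (M0 * 2 ^ (S N + n) * K0 ^ S n * INR (fact (S N + n))) with (K0 * B)
      by (unfold B; simpl; ring).
    simpl TD. change (fact (S N)) with (S N * fact N)%nat in H1, H2. rewrite mult_INR in H1, H2.
    set (A1 := TD n (S N) i z) in *. set (A2 := TD n (S N) (S i) z) in *.
    apply Rle_trans with (K0 * (INR (S N) * INR (fact N)) * Rmax (Rabs A1) (Rabs A2)).
    + rewrite <- Rmult_assoc, Rmult_assoc, (Rmult_comm (INR (fact N))), <- Rmult_assoc.
      apply Rmult_le_compat_r; [apply pos_INR|].
      pose proof (Rmax_l (Rabs A1) (Rabs A2)) as Hm1. pose proof (Rmax_r (Rabs A1) (Rabs A2)) as Hm2.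
      set (mx := Rmax (Rabs A1) (Rabs A2)) in *.
      assert (Hmx : 0 <= mx) by (generalize (Rabs_pos A1); lra).
      assert (HN : 1 <= INR (S N)) by (rewrite S_INR; generalize (pos_INR N); lra).
      eapply Rle_trans; [apply Rabs_triang|]. rewrite !Rabs_mult, Rabs_Ropp.
      apply Rle_trans with ((Rabs x + Rabs q * INR N) * mx + Rabs l * mx).
      * apply Rplus_le_compat.
        -- apply Rmult_le_compat; try apply Rabs_pos; auto.
           eapply Rle_trans; [apply Rabs_triang|].
           rewrite Rabs_mult, (Rabs_pos_eq (INR N)) by apply pos_INR. lra.
        -- apply Rmult_le_compat_l; [apply Rabs_pos|auto].
      * rewrite <- Rmult_plus_distr_r. apply Rmult_le_compat_r; auto.
        unfold K0. rewrite S_INR. generalize (Rabs_pos x) (Rabs_pos q) (Rabs_pos l) (pos_INR N); nra.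
    + rewrite Rmult_assoc. apply Rmult_le_compat_l; auto.
      rewrite Rmult_comm. unfold Rmax; destruct (Rle_dec _ _); auto.
Qed.

Lemma real_egf : exists u : nat -> R, locally 0 (fun z =>
  is_series (fun n => u n * (z ^ n / INR (fact n)))
    (/ Rpower (1 + q * z) (x / q) * Lif k (l * ln (1 + q * z) / q) b)).
Proof.
  exists (fun n => TD n 0%nat 0%nat 0).
  assert (HK : 0 <= K0).
  { unfold K0. generalize (Rabs_pos x) (Rabs_pos q) (Rabs_pos l); lra. }
  assert (HK2 : 0 <= 2 * K0) by lra.
  generalize (taylor_series r M0 (2 * K0) r_pos HK2 (fun n => TD n 0%nat 0%nat)).
  intros H.
  assert (HT : locally 0 (fun z => is_series
    (fun n => TD n 0%nat 0%nat 0 * (z ^ n / INR (fact n))) (TD 0%nat 0%nat 0%nat z))).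
  { apply H; split; [intros; apply TD_derive; assumption|]. intros n z Hz.
    generalize (TD_bound n 0%nat 0%nat z Hz). rewrite Rpow_mult_distr.
    simpl (fact 0). simpl (0 + n)%nat. change (INR 1) with 1. lra. }
  apply filter_imp with (2 := HT).
  intros z Hs. simpl in Hs. unfold E in Hs. simpl in Hs.
  rewrite !Rplus_0_r in Hs. unfold Rpower. rewrite <- exp_Ropp, <- Ropp_mult_distr_l_reverse. exact Hs.
Qed.
End Existence.

Lemma poly_cauchy_exists (k : nat) (a q : R) (L : list R) (la : C) (m : nat) (x : R) :
  q <> 0 -> (forall j : nat, a + INR j <> 0) ->
  exists c : nat -> C, is_poly_cauchy k a q L la m x c.
Proof.
  intros Hq Ha.
  destruct (INR_dist_bound (a + INR m)) as [d [Hd Hbd]].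
  { intros j. rewrite Rplus_assoc, <- plus_INR. apply Ha. }
  destruct (real_egf k (a + INR m) d Hd Hbd q x (prod_list L) Hq) as [u Hu].
  set (K := (a + INR m) ^ k / a ^ k).
  exists (fun n => (la * RtoC (K * u n))%C).
  apply filter_imp with (2 := Hu). intros z Hz.
  apply (is_series_scal (V := R_NormedModule) K) in Hz.
  assert (Hak : a ^ k <> 0).
  { apply pow_nonzero. generalize (Ha 0%nat); simpl; rewrite Rplus_0_r; auto. }
  assert (Hf := filterlim_comp _ _ _ _ (fun t : R => scal t (la : C_R_NormedModule)) _ _ _ Hz
    (filterlim_scal_l (K := R_AbsRing) (V := C_R_NormedModule) _ _)).
  assert (Hsc : forall t : R, scal t (la : C_R_NormedModule) = (la * RtoC t)%C).
  { intros t. rewrite scal_R_Cmult. apply Cmult_comm. }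
  unfold is_series, poly_cauchy_gf.
  match type of Hf with filterlim _ _ (locally ?y) =>
    match goal with |- filterlim _ _ (locally ?y') => replace y' with y end end.
  - eapply filterlim_ext; [|exact Hf].
    intros n; cbv beta. rewrite Hsc. induction n as [|n IH].
    + rewrite !sum_O. rewrite <- Cmult_assoc, <- RtoC_mult. do 2 f_equal. symmetry; apply Rmult_assoc.
    + rewrite !sum_Sn, <- IH.
      rewrite <- (Cmult_assoc la), <- RtoC_mult, Rmult_assoc.
      etransitivity; [|apply Cmult_plus_distr_l]. rewrite <- RtoC_plus. reflexivity.
  - rewrite Hsc. do 2 f_equal.
    assert (Rpower (1 + q * z) (x / q) <> 0) by (apply Rgt_not_eq, exp_pos).
    unfold scal; simpl; unfold mult, K; simpl. field; auto.
Qed.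

(* Main.v *)
Require Import Defs.
From Stdlib Require Import Reals List Factorial Lia Lra.
From Coquelicot Require Import Coquelicot.
Open Scope R_scope.

(** The n-th derivative at 0 of the generating function is, up to the constant
    factor, [P_n(0)], where [P_n(i) = ((E - x) (E - x - q) ... (E - x - (n-1) q) f)(i)],
    [f(i) = 1 / (a + m + i)^k] and [E] is the operator [(E f)(i) = l f(i + 1)].
    The recurrence of the weighted Stirling numbers says exactly that they
    expand [E^n] on the basis [(E - x) ... (E - x - (i-1) q)], and evaluating
    this operator identity on [f] at 0 gives the result. *)

(** * Recurrence of the weighted Stirling numbers and expansion of operator powers *)

(** Split one factor [y + j] of the power as [(y + i + 1) - (i + 1 - j)]; the second piece lowers
    [i] because [(i + 1 - j) C(i + 1, j) = (i + 1) C(i, j)]. *)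
Lemma wstirling2_S_S (n i : nat) (y : R) :
  wstirling2 (S n) (S i) y = wstirling2 n i y + (y + INR (S i)) * wstirling2 n (S i) y.
Proof.
  unfold wstirling2. rewrite !sum_n_Reals.
  set (T := fun p j => Binomial.C (S i) j * (-1) ^ (S i - j) * (y + INR j) ^ p).
  fold (T n) (T (S n)).
  assert (H : (y + INR (S i)) * sum_f_R0 (T n) (S i) - sum_f_R0 (T (S n)) (S i)
    = - INR (S i) * sum_f_R0 (fun j => Binomial.C i j * (-1) ^ (i - j) * (y + INR j) ^ n) i).
  { rewrite !scal_sum, <- minus_sum, tech5.
    replace (T n (S i) * (y + INR (S i)) - T (S n) (S i)) with 0 by (unfold T; simpl; ring).
    rewrite Rplus_0_r. apply sum_eq; intros j Hj. unfold T, Binomial.C.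
    replace (S i - j)%nat with (S (i - j)) by lia.
    rewrite !fact_simpl, !mult_INR, !S_INR, minus_INR by lia.
    assert (INR i - INR j + 1 <> 0) by (apply le_INR in Hj; lra).
    simpl pow. field. repeat split; auto using INR_fact_neq_0. }
  rewrite fact_simpl, mult_INR.
  assert (Hi : INR (S i) <> 0) by (apply not_0_INR; lia).
  apply (f_equal (Rmult (/ (INR (S i) * INR (fact i))))) in H.
  apply Rminus_diag_uniq.
  set (A := sum_f_R0 (T n) (S i)) in *. set (B := sum_f_R0 (T (S n)) (S i)) in *.
  set (D := sum_f_R0 _ i) in *.
  replace (/ INR (fact i) * D) with
    (- (/ (INR (S i) * INR (fact i)) * (- INR (S i) * D)))
    by (field; auto using INR_fact_neq_0).
  rewrite <- H. ring.
Qed.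

Lemma wstirling2_S_O (n : nat) (y : R) :
  wstirling2 (S n) 0 y = y * wstirling2 n 0 y.
Proof.
  unfold wstirling2. rewrite !sum_O. simpl. ring.
Qed.

Lemma wstirling2_O_O (y : R) : wstirling2 0 0 y = 1.
Proof.
  unfold wstirling2, Binomial.C. rewrite sum_O. simpl. field.
Qed.

Lemma wstirling2_gt (n : nat) : forall (i : nat) (y : R), (n < i)%nat -> wstirling2 n i y = 0.
Proof.
  induction n as [|n IH]; intros [|i] y Hi; try lia.
  - unfold wstirling2. rewrite sum_n_Reals.
    (* At [n = 0] the alternating sum is the binomial expansion of [(1 + -1) ^ (S i)]. *)
    rewrite (sum_eq _ (fun j => Binomial.C (S i) j * 1 ^ j * (-1) ^ (S i - j))).
    + rewrite <- binomial. replace (1 + -1) with 0 by ring. simpl; ring.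
    + intros j _. rewrite pow1. simpl; ring.
  - rewrite wstirling2_S_S, !IH by lia. ring.
Qed.

(** The index [i] stays general because the induction hypothesis is used at [S i]. The powers of [q]
    turn [x + q s] into [q (x / q + s)], which carries the factor of the Stirling recurrence. *)
Lemma wstirling2_expansion (q x l : R) (P : nat -> nat -> R) : q <> 0 ->
  (forall n i, P (S n) i = l * P n (S i) - (x + q * INR n) * P n i) ->
  forall n i, sum_f_R0 (fun s => q ^ (n - s) * wstirling2 n s (x / q) * P s i) n
    = l ^ n * P 0%nat (i + n)%nat.
Proof.
  intros Hq HP. induction n as [|n IH]; intros i.
  - simpl. rewrite wstirling2_O_O, Nat.add_0_r. ring.
  - replace (i + S n)%nat with (S i + n)%nat by lia.
    simpl (l ^ S n). rewrite Rmult_assoc, <- IH, scal_sum.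
    (* Replacing [l * P s (S i)] by [P (S s) i + (x + q * s) * P s i] leaves, after index [N], one
       unmatched multiple of [P (S N) i]; the Stirling recurrence absorbs it at the next index. *)
    assert (Hp : forall N, (N <= n)%nat ->
      sum_f_R0 (fun s => q ^ (n - s) * wstirling2 n s (x / q) * P s (S i) * l) N
      = sum_f_R0 (fun s => q ^ (S n - s) * wstirling2 (S n) s (x / q) * P s i) N
        + q ^ (n - N) * wstirling2 n N (x / q) * P (S N) i).
    { induction N as [|N IHN]; intros HN.
      - simpl sum_f_R0. rewrite HP, wstirling2_S_O, Nat.sub_0_r. simpl. field; auto.
      - rewrite !tech5, IHN by lia. rewrite (HP (S N)), wstirling2_S_S.
        replace (S n - S N)%nat with (n - N)%nat by lia.
        replace (n - N)%nat with (S (n - S N)) by lia.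
        simpl pow. field; auto. }
    (* At [N = n] the unmatched term is exactly the one of index [S n], since [wstirling2 n (S n)]
       vanishes. *)
    rewrite Hp, tech5, wstirling2_S_S, (wstirling2_gt n (S n)) by lia.
    rewrite !Nat.sub_diag. ring.
Qed.

(** * Values at 0 of the derivatives [TD] *)

Lemma Lif_0 (k : nat) (b : R) : Lif k 0 b = / b ^ k.
Proof.
  unfold Lif. apply is_series_unique.
  apply (filterlim_ext (fun _ => / b ^ k)); [|apply filterlim_const].
  intros n. induction n as [|n IH].
  - rewrite sum_O. simpl. rewrite Rplus_0_l. unfold Rdiv. rewrite Rinv_1. ring.
  - rewrite sum_Sn, <- IH. unfold plus; simpl. unfold Rdiv; ring.
Qed.

(** At [z = 0] the base [1 + q * z] is 1, so its exponent, the only place where [N] enters, has no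
    effect. This independence from [N] starts the induction of [TD_S_last]. *)
Lemma TD_0_at_0 (k : nat) (b q x l : R) (N i : nat) :
  TD k b q x l 0 N i 0 = / (b + INR i) ^ k.
Proof.
  simpl. rewrite Rmult_0_r, Rplus_0_r, ln_1, !Rmult_0_r, exp_0.
  unfold Rdiv. rewrite Rmult_0_l, Lif_0. ring.
Qed.

(* [TD] is defined by peeling off the first factor of the product of operators
   [E - x - q j]; since these commute, the last one can be peeled off instead. *)
Lemma TD_S_last (k : nat) (b q x l : R) (n : nat) : forall N i,
  TD k b q x l (S n) N i 0
  = l * TD k b q x l n N (S i) 0 - (x + q * INR (N + n)) * TD k b q x l n N i 0.
Proof.
  assert (HS : forall n N i, TD k b q x l (S n) N i 0 =
    - (x + q * INR N) * TD k b q x l n (S N) i 0 + l * TD k b q x l n (S N) (S i) 0)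
    by reflexivity.
  induction n as [|n IH]; intros N i.
  - rewrite HS, Nat.add_0_r, !TD_0_at_0. ring.
  - rewrite (HS (S n)), !(IH (S N)), !(HS n).
    replace (S N + n)%nat with (N + S n)%nat by lia. ring.
Qed.

(** * Uniqueness of coefficients and the explicit Taylor series *)

(** If the radius were below [e / 2], the terms at that point could not tend to 0, although the
    series converges there. *)
Lemma CV_radius_pos_of_series (u : nat -> R) :
  locally 0 (fun z => ex_series (fun n => u n * z ^ n)) -> Rbar_lt 0 (CV_radius u).
Proof.
  intros [e He].
  assert (Hp := cond_pos e).
  apply Rbar_lt_le_trans with (e / 2); [simpl; lra|].
  apply Rbar_not_lt_le; intros Hlt.
  apply (CV_disk_outside u (e / 2)).
  - rewrite Rabs_pos_eq by lra. exact Hlt.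
  - apply ex_series_lim_0, He.
    unfold ball; simpl; unfold AbsRing_ball, abs, minus, plus, opp; simpl.
    rewrite Rabs_pos_eq; lra.
Qed.

Lemma egf_unique (u v : nat -> R) (g : R -> R) :
  locally 0 (fun z => is_series (fun n => u n * (z ^ n / INR (fact n))) (g z)) ->
  locally 0 (fun z => is_series (fun n => v n * (z ^ n / INR (fact n))) (g z)) ->
  forall n, u n = v n.
Proof.
  intros Hu Hv n.
  assert (Hs : forall w : nat -> R,
    locally 0 (fun z => is_series (fun n => w n * (z ^ n / INR (fact n))) (g z)) ->
    locally 0 (fun z => is_series (fun n => w n / INR (fact n) * z ^ n) (g z))).
  { intros w. apply filter_imp; intros z. apply is_series_ext; intros j. simpl; unfold Rdiv; ring. }
  apply Hs in Hu. apply Hs in Hv.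
  assert (H : u n / INR (fact n) = v n / INR (fact n)).
  { apply (PSeries_ext_recip (fun n => u n / INR (fact n)) (fun n => v n / INR (fact n)) n).
    - apply CV_radius_pos_of_series. revert Hu. apply filter_imp; intros z Hz. eexists; exact Hz.
    - apply CV_radius_pos_of_series. revert Hv. apply filter_imp; intros z Hz. eexists; exact Hz.
    - generalize (filter_and _ _ Hu Hv). apply filter_imp; intros z [H1 H2].
      unfold PSeries. rewrite (is_series_unique _ _ H1), (is_series_unique _ _ H2). reflexivity. }
  apply Rmult_eq_reg_r with (/ INR (fact n)); [exact H|].
  apply Rinv_neq_0_compat, INR_fact_neq_0.
Qed.

(** Unlike [real_egf], this names the coefficients, so that [egf_unique] can identify any other
    expansion with them. *)
Lemma TD_egf (k : nat) (b q x l : R) : q <> 0 -> (forall j : nat, b + INR j <> 0) ->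
  locally 0 (fun z =>
    is_series (fun n => TD k b q x l n 0 0 0 * (z ^ n / INR (fact n)))
      (/ Rpower (1 + q * z) (x / q) * Lif k (l * ln (1 + q * z) / q) b)).
Proof.
  intros Hq Hb. destruct (INR_dist_bound b Hb) as [d [Hd Hbd]].
  eapply filter_imp.
  (* Within this radius [1 + q * z] lies between 1/2 and 2. The next constant bounds [TD 0 0 0], and
     the last is the growth rate per derivative from [TD_bound]. *)
  2:{ apply (taylor_series (/ (2 * Rabs q))
        (exp (Rabs (x / q) * 1) * ((/ d) ^ k * exp (Rabs (l / q))))
        (2 * (Rabs x + Rabs q + Rabs l)) (r_pos q Hq)) with (D := fun n => TD k b q x l n 0 0).
      - generalize (Rabs_pos x) (Rabs_pos q) (Rabs_pos l); lra.
      - split; intros n z Hz; [apply TD_derive with d; assumption|].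
        generalize (TD_bound k b d Hd Hbd q x l Hq n 0 0 z Hz). rewrite Rpow_mult_distr.
        simpl (fact 0). simpl (0 + n)%nat. change (INR 1) with 1. lra. }
  intros z Hs. simpl in Hs. rewrite !Rplus_0_r in Hs.
  unfold Rpower. rewrite <- exp_Ropp, <- Ropp_mult_distr_l_reverse. exact Hs.
Qed.

(** * Passage from real to complex coefficients *)

Lemma is_series_C_components (u : nat -> C) (s : C) :
  is_series (V := C_R_NormedModule) u s ->
  is_series (fun n => fst (u n)) (fst s) /\ is_series (fun n => snd (u n)) (snd s).
Proof.
  intros H. destruct s as [s1 s2].
  assert (Hf : forall n, sum_n (fun n => fst (u n)) n
      = fst (sum_n (G := C_R_NormedModule) u n)
    /\ sum_n (fun n => snd (u n)) n = snd (sum_n (G := C_R_NormedModule) u n)).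
  { induction n as [|n [IH1 IH2]]; [rewrite !sum_O; auto|].
    rewrite !sum_Sn, IH1, IH2. split; reflexivity. }
  split.
  - apply (filterlim_ext (fun n => fst (sum_n (G := C_R_NormedModule) u n))).
    { intros n; symmetry; apply Hf. }
    exact (filterlim_comp _ _ _ _ _ _ _ _ H
      (continuous_fst (U := R_UniformSpace) (V := R_UniformSpace) s1 s2)).
  - apply (filterlim_ext (fun n => snd (sum_n (G := C_R_NormedModule) u n))).
    { intros n; symmetry; apply Hf. }
    exact (filterlim_comp _ _ _ _ _ _ _ _ H
      (continuous_snd (U := R_UniformSpace) (V := R_UniformSpace) s1 s2)).
Qed.

Lemma poly_cauchy_TD (k : nat) (a q : R) (L : list R) (la : C) (m : nat) (x : R) (c : nat -> C) :
  q <> 0 -> (forall j : nat, a + INR j <> 0) -> is_poly_cauchy k a q L la m x c ->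
  forall n, c n = (la * RtoC ((a + INR m) ^ k / a ^ k
                              * TD k (a + INR m) q x (prod_list L) n 0 0 0))%C.
Proof.
  intros Hq Ha Hc n.
  assert (Hak : a ^ k <> 0).
  { apply pow_nonzero. generalize (Ha 0%nat); simpl; rewrite Rplus_0_r; auto. }
  (* [s] will be the real part, then the imaginary part, of [la]: uniqueness is only available for
     real series. *)
  assert (HT : forall s : R, locally 0 (fun z =>
    is_series (fun n => s * ((a + INR m) ^ k / a ^ k
        * TD k (a + INR m) q x (prod_list L) n 0 0 0) * (z ^ n / INR (fact n)))
      (s * ((a + INR m) ^ k / (a ^ k * Rpower (1 + q * z) (x / q)) *
              Lif k (prod_list L * ln (1 + q * z) / q) (a + INR m))))).
  { intros s. generalize (TD_egf k (a + INR m) q x (prod_list L) Hq).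
    intros H. eapply filter_imp; [|apply H].
    2:{ intros j. rewrite Rplus_assoc, <- plus_INR. apply Ha. }
    intros z Hz.
    apply (is_series_scal (V := R_NormedModule) (s * ((a + INR m) ^ k / a ^ k))) in Hz.
    assert (Rpower (1 + q * z) (x / q) <> 0) by (apply Rgt_not_eq, exp_pos).
    evar_last.
    - eapply is_series_ext; [|exact Hz].
      intros j. unfold scal; simpl; unfold mult; simpl. ring.
    - unfold scal; simpl; unfold mult; simpl. field; auto. }
  apply injective_projections.
  - transitivity (fst la * ((a + INR m) ^ k / a ^ k
      * TD k (a + INR m) q x (prod_list L) n 0 0 0)); [|simpl; ring].
    refine (egf_unique (fun n => fst (c n)) _ _ _ (HT (fst la)) n).
    revert Hc. unfold is_poly_cauchy, is_egf. apply filter_imp; intros z Hz.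
    apply is_series_C_components, proj1 in Hz.
    evar_last; [eapply is_series_ext; [|exact Hz]; intros j; simpl; ring|simpl; ring].
  - transitivity (snd la * ((a + INR m) ^ k / a ^ k
      * TD k (a + INR m) q x (prod_list L) n 0 0 0)); [|simpl; ring].
    refine (egf_unique (fun n => snd (c n)) _ _ _ (HT (snd la)) n).
    revert Hc. unfold is_poly_cauchy, is_egf. apply filter_imp; intros z Hz.
    apply is_series_C_components, proj2 in Hz.
    evar_last; [eapply is_series_ext; [|exact Hz]; intros j; simpl; ring|simpl; ring].
Qed.

Theorem theorem14 (k : nat) (a q : R) (L : list R) (la : C)
    (hk : (1 <= k)%nat) (hLk : length L = k)
    (ha : a <> 0) (hq : q <> 0) (hL : forall y : R, In y L -> y <> 0)
    (haj : forall j : nat, a + INR j <> 0)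
    (hla : is_power (prod_list L) a la)
    (n m : nat) (x : R)
    (c : nat -> C) (hc : is_poly_cauchy k a q L la m x c) :
  sum_n (fun i : nat =>
           (RtoC (q ^ (n - i) * wstirling2 n i (x / q)) * c i)%C) n
  = (la * RtoC ((a + INR m) ^ k * prod_list L ^ n
                / (a ^ k * (a + INR n + INR m) ^ k)))%C.
Proof.
  set (T := fun s i => TD k (a + INR m) q x (prod_list L) s 0 i 0).
  (* The upper bound [N] varies while the weights keep the fixed [n], so that induction can pull
     [la] out and leave a real sum. *)
  assert (Hsum : forall N, sum_n (fun i : nat =>
      (RtoC (q ^ (n - i) * wstirling2 n i (x / q)) * c i)%C) N
    = (la * RtoC ((a + INR m) ^ k / a ^ k *
        sum_f_R0 (fun s => q ^ (n - s) * wstirling2 n s (x / q) * T s 0%nat)%R N))%C).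
  { induction N as [|N IH].
    - rewrite sum_O, (poly_cauchy_TD k a q L la m x c hq haj hc).
      fold (T 0%nat 0%nat). simpl sum_f_R0. rewrite !RtoC_mult.
      match goal with |- ?u = ?v => change (@eq C u v) end. ring.
    - rewrite sum_Sn, IH, (poly_cauchy_TD k a q L la m x c hq haj hc), tech5.
      fold (T (S N) 0%nat). rewrite Rmult_plus_distr_l, RtoC_plus, !RtoC_mult.
      match goal with |- plus ?u ?v = ?w => change (@eq C (Cplus u v) w) end. ring. }
  rewrite Hsum, (wstirling2_expansion q x (prod_list L) T hq).
  (* What remains is [f] after [n] shifts from index 0. *)
  - unfold T. rewrite TD_0_at_0. simpl (0 + n)%nat.
    replace (a + INR m + INR n) with (a + INR n + INR m) by ring.
    do 2 f_equal. field. split; apply pow_nonzero; auto.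
    rewrite Rplus_assoc, <- plus_INR. apply haj.
  - intros s i. apply TD_S_last.
Qed.
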